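(* Let $d,N$ be positive integers, let $C_1,\ldots,C_N\subset\mathbb{R}^d$ be closed convex sets which satisfy $\bigcap_{j=1}^N C_j\neq\emptyset$, and let the matrix $D^0\in\mathbb{R}^{N\times N}_{\ge 0}$ and the policy $\phi:\{1,\ldots,N\}\times\mathbb{R}^{N\times N}_{\ge 0}\to\mathbb{R}_{\ge 0}$ be admissible. Then for every sequence $(x_k)_{k\in\mathbb{N}}\in(\mathbb{R}^d)^{\mathbb{N}}$ generated by the projection algorithm with memory (PAM) with inputs $C_1,\ldots,C_N$, $x_0\in C_1$, $D^0$ and $\phi$, there exists $x^*\in\bigcap_{j=1}^N C_j$ such that \[\lim_{k\to\infty}x_k=x^*.\]
   Context: Here $\mathbb{N}=\{0,1,2,\ldots\}$, $\mathbb{R}_{\ge 0}$ is the set of nonnegative reals, $\mathbb{R}^{N\times N}_{\ge 0}$ is the set of $N\times N$ matrices with nonnegative real entries, $\|\cdot\|$ is the Euclidean norm, and $\mathrm{proj}(x,C):=\mathrm{argmin}_{z\in C}\|x-z\|$ denotes the (unique) projection of $x\in\mathbb{R}^d$ onto a nonempty closed convex set $C\subset\mathbb{R}^d$. Admissible matrix: $D\in\mathbb{R}^{N\times N}_{\ge 0}$ is called admissible if (i) $D_{m,m}=0$ for all $m\in\{1,\ldots,N\}$, and (ii) for any $m,n\in\{1,\ldots,N\}$ with $m\neq n$ there exist $\ell\in\mathbb{N}$ and indices $i_1,\ldots,i_\ell\in\{1,\ldots,N\}$ such that $i_1=m$, $i_\ell=n$ and $D_{i_s,i_{s+1}}>0$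 for all $s\in\{1,\ldots,\ell-1\}$. Admissible policy: a function $\phi:\{1,\ldots,N\}\times\mathbb{R}^{N\times N}_{\ge 0}\to\mathbb{R}_{\ge 0}$ is called an admissible policy if there exists $\beta\in(0,1)$ such that (i) $\phi(m,D)>0$ for all $m\in\{1,\ldots,N\}$ and $D\in\mathbb{R}^{N\times N}_{\ge 0}$ satisfying $\max_n D_{m,n}\neq 0$, and (ii) $\phi(m,D)\le\beta\max_n D_{m,n}$ for all $m\in\{1,\ldots,N\}$ and $D\in\mathbb{R}^{N\times N}_{\ge 0}$. Projection algorithm with memory (PAM): given $C_1,\ldots,C_N\subset\mathbb{R}^d$, $x_0\in C_1$, $D^0\in\mathbb{R}^{N\times N}_{\ge 0}$ and a function $\phi:\{1,\ldots,N\}\times\mathbb{R}^{N\times N}_{\ge 0}\to\mathbb{R}_{\ge 0}$, the algorithm sets $j_0=1$ and for $k=0,1,2,\ldots$ performs the following steps: 1. choose $j_{k+1}\in\mathrm{argmax}_{\ell\in\{1,\ldots,N\}\setminus\{j_k\}}D^k_{j_k,\ell}$ (by a uniform random sample from this set of maximizers; the statement concerns every possible outcome of these choices); 2. set $x_{k+1}=\mathrm{proj}(x_k,C_{j_{k+1}})$; 3. set $D^{k+1}_{j_k,j_{k+1}}=\max\{\|x_{k+1}-x_k\|,\phi(j_k,D^k)\}$, and $D^{k+1}_{m,n}=D^k_{m,n}$ for all $(m,n)\neq(j_k,j_{k+1})$. The sequences $(j_k)_{k\in\mathbb{N}}$, $(x_k)_{k\in\mathbb{N}}$, $(D^k)_{k\in\mathbb{N}}$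 obtained in this way are said to be generated by PAM. *)

(* Defs.v *)
From mathcomp Require Export all_boot all_order all_algebra.
From mathcomp Require Export all_classical all_reals all_analysis.
Export Order.TTheory GRing.Theory Num.Theory numFieldNormedType.Exports.
Set Implicit Arguments.
Unset Strict Implicit.
Unset Printing Implicit Defensive.
Local Open Scope classical_set_scope.
Local Open Scope ring_scope.

(* The library's norm on 'rV[R]_d is the sup norm, hence this definition.  Both
   norms induce the entrywise topology, which is the one that the library uses
   for [closed] and for limits in 'rV[R]_d. *)
Definition enorm (R : realType) (d : nat) (x : 'rV[R]_d) : R :=
  Num.sqrt (\sum_(i < d) x 0 i ^+ 2).

Definition argmin (R : realType) (T : Type) (A : set T) (f : T -> R) : set T :=
  [set a | A a /\ forall b, A b -> f a <= f b].

Definition argmax (R : realType) (T : Type) (A : set T) (f : T -> R) : set T :=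
  [set a | A a /\ forall b, A b -> f b <= f a].

Definition is_proj (R : realType) (d : nat) (x : 'rV[R]_d)
    (C : set 'rV[R]_d) (z : 'rV[R]_d) : Prop :=
  argmin C (fun z' => enorm (x - z')) z.

Definition nonneg_mx (R : realType) (N : nat) (D : 'M[R]_N) : Prop :=
  forall m n, 0 <= D m n.

(* Used for nonnegative matrices only, where the default value 0 of the big
   operator does not affect the maximum. *)
Definition row_max (R : realType) (N : nat) (D : 'M[R]_N) (m : 'I_N) : R :=
  \big[Num.max/0]_(n < N) D m n.

(* The indices i_1 = m, i_2, ..., i_l are the entries of [m :: p]. *)
Definition admissible_matrix (R : realType) (N : nat) (D : 'M[R]_N) : Prop :=
  [/\ nonneg_mx D,
      forall m, D m m = 0 &
      forall m n, m != n -> exists p : seq 'I_N,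
        path (fun a b => 0 < D a b) m p /\ last m p = n].

(* A policy is a function {1..N} x R_{>=0}^{N x N} -> R_{>=0}.  It is encoded as
   a function on all real matrices whose values outside the nonnegative
   matrices are irrelevant; the first clause is the codomain condition. *)
Definition admissible_policy (R : realType) (N : nat)
    (phi : 'I_N -> 'M[R]_N -> R) : Prop :=
  (forall m D, nonneg_mx D -> 0 <= phi m D) /\
  exists beta : R,
    [/\ 0 < beta < 1,
        forall m D, nonneg_mx D -> row_max D m != 0 -> 0 < phi m D &
        forall m D, nonneg_mx D -> phi m D <= beta * row_max D m].

(* Indices are shifted by one: the index 1 is the ordinal 0.  The choice of
   [j k.+1] is an arbitrary maximizer, so that all outcomes of the random
   sampling are covered. *)
Record generated_by_PAM (R : realType) (d N : nat) (hN : (0 < N)%N)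
    (C : 'I_N -> set 'rV[R]_d) (x0 : 'rV[R]_d) (D0 : 'M[R]_N)
    (phi : 'I_N -> 'M[R]_N -> R)
    (j : nat -> 'I_N) (x : nat -> 'rV[R]_d) (D : nat -> 'M[R]_N) : Prop := {
  PAM_j0 : j 0%N = Ordinal hN;
  PAM_x0 : x 0%N = x0;
  PAM_D0 : D 0%N = D0;
  PAM_index : forall k, argmax [set l | l != j k] (D k (j k)) (j k.+1);
  PAM_proj : forall k, is_proj (x k) (C (j k.+1)) (x k.+1);
  PAM_update : forall k m n, D k.+1 m n =
    if (m == j k) && (n == j k.+1)
    then Num.max (enorm (x k.+1 - x k)) (phi (j k) (D k))
    else D k m n
}.

(* Main.v *)
Require Import Defs.
From mathcomp Require Import ring lra.
Local Open Scope classical_set_scope.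
Local Open Scope ring_scope.

(** The argument separates the geometry of projections from the bookkeeping of
    the memory matrix.

    Geometry ([cvg_proj_arbitrary_order]): successive projections onto finitely
    many closed convex sets with a common point converge to a common point as
    soon as every set is used infinitely often, in whatever order.  By Fejer
    monotonicity with respect to a common point the iterates are bounded, and
    the squared step lengths are bounded by the decrease of a nonnegative
    sequence, so the steps tend to 0 ([steps_cvg0]).  Let [p] be a limit point.
    The sets that miss [p] stay at a positive distance from it, so once an
    iterate is close to [p] and the steps are short, the next set contains [p];
    projecting onto it does not move the iterate away from [p], and the
    situation persists ([cluster_captures]).  Hence only sets containing [p] are
    used from then on, so all sets contain [p], and the iterates, which approach
    [p] along a subsequence and never move away from it, converge to [p].

    Bookkeeping ([PAM_recurrent]): the algorithm visits every index infinitely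
    often.  Some index is visited infinitely often, and indices are joined by
    paths of positive entries of the initial matrix, so it is enough to show
    that if [m] is visited infinitely often and the entry (m, n) is positive,
    then [n] is visited infinitely often ([recurrent_successor]).  Otherwise
    that entry is eventually a constant [c > 0].  A visit to [m] then
    overwrites an entry that is at least [c] by one at most [beta] times as
    large, the steps being short; the m-th row sum loses at least
    [(1 - beta) * c] at each visit, which a nonnegative quantity cannot do
    infinitely often. *)

Set Implicit Arguments.
Unset Strict Implicit.
Unset Printing Implicit Defensive.

(** * Projections in Euclidean space *)

Section EuclideanGeometry.
Variables (R : realType) (d : nat).
Implicit Types (u v x y z : 'rV[R]_d) (C : set 'rV[R]_d).

Definition dot u v : R := \sum_(i < d) u 0 i * v 0 i.

Lemma enorm_ge0 u : 0 <= enorm u.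
Proof. exact: sqrtr_ge0. Qed.

Lemma sqr_enorm u : enorm u ^+ 2 = dot u u.
Proof.
rewrite sqr_sqrtr; last by apply: sumr_ge0 => i _; exact: sqr_ge0.
by apply: eq_bigr => i _; rewrite expr2.
Qed.

Lemma sqr_enormBZ u v (t : R) :
  enorm (u - t *: v) ^+ 2
  = enorm u ^+ 2 - 2 * t * dot u v + t ^+ 2 * enorm v ^+ 2.
Proof.
rewrite !sqr_enorm /dot 2!mulr_sumr -sumrB -big_split/=.
by apply: eq_bigr => i _; rewrite !mxE; ring.
Qed.

Lemma ler_enorm u v : (enorm u <= enorm v) = (enorm u ^+ 2 <= enorm v ^+ 2).
Proof. by rewrite ler_sqr// nnegrE enorm_ge0. Qed.

Lemma coord_le_norm u i : `|u 0 i| <= `|u|.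
Proof.
by rewrite [leRHS]/Num.norm /= mx_normrE; apply: (le_bigmax _ _ (ord0, i)).
Qed.

(** [norm_le_enorm] and [enorm_le_norm] pass between the Euclidean norm, for
    which projections are contractions, and the sup norm, which carries the
    topology and its triangle inequality. *)
Lemma norm_le_enorm u : `|u| <= enorm u.
Proof.
rewrite [leLHS]/Num.norm /= mx_normrE; apply: bigmax_le => [|[i k] _ /=].
  exact: enorm_ge0.
rewrite (ord1 i) -[leLHS]sqrtr_sqr ler_wsqrtr//.
rewrite (bigD1 k)//= lerDl.
by apply: sumr_ge0 => l _; exact: sqr_ge0.
Qed.

Lemma enorm_le_norm u : enorm u <= Num.sqrt d%:R * `|u|.
Proof.
rewrite -[X in _ * X]ger0_norm// -sqrtr_sqr -sqrtrM// ler_wsqrtr//.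
have -> : d%:R * `|u| ^+ 2 = \sum_(i < d) `|u| ^+ 2.
  by rewrite sumr_const card_ord mulr_natl.
rewrite ler_sum// => i _.
by rewrite -(real_normK (num_real _)) ler_sqr ?nnegrE// coord_le_norm.
Qed.

Lemma proj_mem x C z : is_proj x C z -> C z.
Proof. by case. Qed.

(** Moving from [z] towards [y] by a fraction [t] stays in [C], so it cannot
    come closer to [x]; the term of first order in [t] decides the sign. *)
Lemma proj_obtuse x C z y :
  @convex_set R 'rV[R]_d C -> is_proj x C z -> C y -> dot (x - z) (y - z) <= 0.
Proof.
move=> Cconv [Cz zmin] Cy.
have first_order (t : R) : 0 < t <= 1 ->
    2 * dot (x - z) (y - z) <= t * enorm (y - z) ^+ 2.
  move=> /andP[t0 t1].
  have Cw : C (z + t *: (y - z)).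
    have := Cconv y z (Itv01 (ltW t0) t1); rewrite !inE => /(_ Cy Cz).
    rewrite [X in C X -> _](_ : _ = t *: y + (1 - t) *: z)//.
    by rewrite scalerBr scalerBl scale1r addrCA.
  have := zmin _ Cw; rewrite ler_enorm opprD addrA sqr_enormBZ => le.
  have : t * (2 * dot (x - z) (y - z)) <= t * (t * enorm (y - z) ^+ 2) by lra.
  by rewrite ler_pM2l.
rewrite leNgt; apply/negP => pos.
set e := enorm (y - z) ^+ 2 in first_order.
have e0 : 0 <= e by exact: sqr_ge0.
set c := dot _ _ in first_order pos.
(* t = c / (c + e) lies in ]0, 1] and satisfies t * e < 2 * c. *)
have ce0 : 0 < c + e by lra.
have := first_order (c / (c + e)).
rewrite divr_gt0//= ler_pdivrMr// mul1r lerDl => /(_ e0).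
rewrite mulrAC ler_pdivlMr//; nra.
Qed.

(** The triangle [x], [z], [y] has a right or obtuse angle at [z]. *)
Lemma proj_pythagoras x C z y :
  @convex_set R 'rV[R]_d C -> is_proj x C z -> C y ->
  enorm (z - y) ^+ 2 + enorm (z - x) ^+ 2 <= enorm (x - y) ^+ 2.
Proof.
move=> Cconv zproj Cy; have := proj_obtuse Cconv zproj Cy.
have := sqr_enormBZ (x - z) (y - z) 1.
rewrite scale1r opprB addrA subrK => ->.
have -> : enorm (z - y) = enorm (y - z).
  congr Num.sqrt; apply: eq_bigr => i _; rewrite !mxE; ring.
have -> : enorm (z - x) = enorm (x - z).
  congr Num.sqrt; apply: eq_bigr => i _; rewrite !mxE; ring.
lra.
Qed.

Lemma proj_le x C z y :
  @convex_set R 'rV[R]_d C -> is_proj x C z -> C y ->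
  enorm (z - y) <= enorm (x - y).
Proof.
move=> Cconv zproj Cy; rewrite ler_enorm.
have := proj_pythagoras Cconv zproj Cy; have := sqr_ge0 (enorm (z - x)); lra.
Qed.

End EuclideanGeometry.

(** * Gaps of monotone sequences and limit points *)

Section Sequences.
Variable R : realType.

(** Used twice: the squared distance to a common point makes the steps vanish,
    and the row sums of the memory matrix bound the number of visits. *)
Lemma nonincreasing_gap_cvg0 (u : nat -> R) :
  (forall k, 0 <= u k) -> (\forall k \near \oo, u k.+1 <= u k) ->
  u k - u k.+1 @[k --> \oo] --> 0.
Proof.
move=> u0 [K _ udec].
have cvgu : cvgn [sequence u (k + K)%N]_k.
  apply: nonincreasing_is_cvgn; last by exists 0 => _ [k _ <-]; exact: u0.
  apply/nonincreasing_seqP => k /=; rewrite addSn; apply: udec => /=.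
  by rewrite leq_addl.
rewrite -(subrr (limn [sequence u (k + K)%N]_k)).
apply: cvgB; first by rewrite -(cvg_shiftn K).
by rewrite (cvg_shiftS u) -(cvg_shiftn K).
Qed.

Lemma bounded_cluster (d : nat) (x : nat -> 'rV[R]_d) (B : R) :
  (forall k, `|x k| <= B) -> exists p, cluster (x @ \oo) p.
Proof.
move=> xB.
have cpt : compact [set v : 'rV[R]_d | `|v| <= B].
  apply: bounded_closed_compact.
    exists B; split=> [|M BM v /= /le_trans]; first exact: num_real.
    by apply; exact: ltW.
  apply: (@preimage_closed _ _ (fun v : 'rV[R]_d => `|v|) [set r | r <= B]).
    by move=> v _; exact: norm_continuous.
  exact: closed_le.
have [|p [_ px]] := cpt (x @ \oo) _; last by exists p.
by exists 0%N => // k _ /=.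
Qed.

End Sequences.

(** * Projections in arbitrary order *)

Section ArbitraryOrder.
Variables (R : realType) (d : nat).

Lemma cluster_enorm (x : nat -> 'rV[R]_d) p (e : R) K :
  cluster (x @ \oo) p -> 0 < e -> exists2 k, (K <= k)%N & enorm (x k - p) < e.
Proof.
move=> px e0.
(* The added 1 makes the divisor positive in dimension 0 as well. *)
have s0 : 0 < Num.sqrt d%:R + 1 :> R by rewrite ltr_wpDl// sqrtr_ge0.
have nearp : nbhs p [set y : 'rV[R]_d | enorm (y - p) < e].
  apply/nbhs_ballP; exists (e / (Num.sqrt d%:R + 1)); first exact: divr_gt0.
  move=> y; rewrite -ball_normE /= distrC ltr_pdivlMr// => yp.
  apply: le_lt_trans (enorm_le_norm _) _; apply: le_lt_trans yp.
  by rewrite mulrC ler_wpM2l// lerDl.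
pose tail : set 'rV[R]_d := [set y | exists2 k, (K <= k)%N & x k = y].
have [|y [[k Kk <-] yp]] := px tail _ _ nearp.
  by exists K => // k Kk; exists k.
by exists k.
Qed.

Variables (T : finType) (C : T -> set 'rV[R]_d).
Hypotheses (C_closed : forall i, closed (C i))
  (C_convex : forall i, @convex_set R 'rV[R]_d (C i))
  (C_meet : \bigcap_(i in [set: T]) C i !=set0).
Variables (j : nat -> T) (x : nat -> 'rV[R]_d).
Hypothesis x_proj : forall k, is_proj (x k) (C (j k.+1)) (x k.+1).

(** The point [y] only has to lie in the sets used from time [k0] on: this
    serves for a common point from the start, and for a limit point once it has
    captured the iteration. *)
Lemma fejer_monotone y k0 k : (forall l, (k0 <= l)%N -> C (j l.+1) y) ->
  (k0 <= k)%N -> enorm (x k - y) <= enorm (x k0 - y).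
Proof.
move=> Cy; elim: k => [|k IHk]; first by rewrite leqn0 => /eqP ->.
rewrite leq_eqVlt => /predU1P[->//|k0k]; apply: le_trans (IHk k0k).
exact: proj_le (@C_convex _) (x_proj k) (Cy _ k0k).
Qed.

(** By the obtuse-angle inequality, the squared step length is at most the gap
    of the squared distance to a common point. *)
Lemma steps_cvg0 : enorm (x k.+1 - x k) @[k --> \oo] --> 0.
Proof.
have [z Cz] := C_meet.
pose u k := enorm (x k - z) ^+ 2.
have step_gap k : enorm (x k.+1 - x k) ^+ 2 <= u k - u k.+1.
  by have := proj_pythagoras (@C_convex _) (x_proj k) (Cz _ I); rewrite /u; lra.
have gap0 : u k - u k.+1 @[k --> \oo] --> 0.
  apply: nonincreasing_gap_cvg0 => [k|]; first exact: sqr_ge0.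
  apply: nearW => k; have := step_gap k.
  by have := sqr_ge0 (enorm (x k.+1 - x k)); lra.
apply/cvgrPdist_lt => e e0.
have e20 : 0 < e ^+ 2 by exact: exprn_gt0.
move/cvgrPdist_lt/(_ _ e20) : gap0; apply: filterS => k.
rewrite !sub0r !normrN (ger0_norm (enorm_ge0 _)) => /(le_lt_trans (ler_norm _)).
move=> /(le_lt_trans (step_gap k)).
by rewrite ltr_sqr ?nnegrE ?enorm_ge0// ltW.
Qed.

Lemma iterates_cluster : exists p, cluster (x @ \oo) p.
Proof.
have [z Cz] := C_meet.
apply: (@bounded_cluster _ _ _ (enorm (x 0%N - z) + `|z|)) => k.
rewrite -[x k](subrK z); apply: le_trans (ler_normD _ _) _.
rewrite lerD2r; apply: le_trans (norm_le_enorm _) _.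
by apply: fejer_monotone => // l _; exact: Cz.
Qed.

(** Each set that misses [p] has an open complement; finiteness of the family
    makes the neighbourhood uniform. *)
Lemma near_member_sets (p : 'rV[R]_d) :
  \forall y \near p, forall i, C i y -> C i p.
Proof.
suff near_i i : \forall y \near p, C i y -> C i p.
  exact: filter_forall near_i.
have [Cp|nCp] := pselect (C i p); first exact: (@nearW _ (nbhs p)).
have : nbhs p (~` C i).
  by apply: open_nbhs_nbhs; split=> //; exact: closed_openC.
by apply: filterS => y nCy /nCy.
Qed.

(** Within distance [e] of [p] there are only sets containing [p].  An iterate
    within [e / 2] of [p] followed by a step shorter than [e / 2] lands in such
    a set, and projecting onto it keeps the distance to [p] below [e / 2]. *)
Lemma cluster_captures p : cluster (x @ \oo) p ->
  \forall k \near \oo, C (j k.+1) p.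
Proof.
move=> px; have /nbhs_ballP[e /= e0 sub] := near_member_sets p.
have e20 : 0 < e / 2 by rewrite divr_gt0.
have /cvgrPdist_lt/(_ _ e20)[K _ small] := steps_cvg0.
have [k0 Kk0 close0] := cluster_enorm K px e20.
have member k : (k0 <= k)%N -> enorm (x k - p) < e / 2 -> C (j k.+1) p.
  move=> k0k close; apply: (sub (x k.+1)); last exact: proj_mem (x_proj k).
  rewrite -ball_normE /= distrC -(subrKA (x k)) (splitr e).
  apply: le_lt_trans (ler_normD _ _) _; apply: ltrD.
    have := small k (leq_trans Kk0 k0k).
    rewrite /= sub0r normrN; apply: le_lt_trans.
    exact: le_trans (norm_le_enorm _) (ler_norm _).
  exact: le_lt_trans (norm_le_enorm _) close.
suff stay k : (k0 <= k)%N -> enorm (x k - p) < e / 2.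
  by exists k0 => // k k0k; exact: member (stay k k0k).
elim: k => [|k IHk].
  by rewrite leqn0 => /eqP k00; move: close0; rewrite k00.
rewrite leq_eqVlt => /predU1P[<-//|k0k].
apply: le_lt_trans (IHk k0k).
exact: proj_le (@C_convex _) (x_proj k) (member _ k0k (IHk k0k)).
Qed.

(** A captured limit point lies in every set because each one is used again;
    monotonicity of the distance to it then turns convergence along a
    subsequence into convergence. *)
Theorem cvg_proj_arbitrary_order :
  (forall i, ~ \forall k \near \oo, j k <> i) ->
  exists2 p, (\bigcap_(i in [set: T]) C i) p & x @ \oo --> p.
Proof.
move=> recurrent; have [p px] := iterates_cluster.
have Cp i : C i p.
  apply: contrapT => nCp; apply: (recurrent i).
  have [K _ captured] := cluster_captures px.
  exists K.+1 => // -[//|k] /= Kk jk.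
  by apply: nCp; rewrite -jk; exact: captured.
exists p => [i _ //|]; apply/cvgrPdist_lt => e e0.
have [k0 _ close0] := cluster_enorm 0 px e0.
exists k0 => // k /= k0k; rewrite distrC.
apply: le_lt_trans (norm_le_enorm _) _; apply: le_lt_trans close0.
by apply: fejer_monotone.
Qed.

End ArbitraryOrder.

(** * Recurrence of the indices *)

Section Memory.
Variables (R : realType) (d N : nat) (hN : (0 < N)%N).
Variables (C : 'I_N -> set 'rV[R]_d) (x0 : 'rV[R]_d) (D0 : 'M[R]_N).
Variables (phi : 'I_N -> 'M[R]_N -> R).
Variables (j : nat -> 'I_N) (x : nat -> 'rV[R]_d) (D : nat -> 'M[R]_N).
Hypotheses (D0_adm : admissible_matrix D0) (phi_adm : admissible_policy phi).
Hypothesis gen : generated_by_PAM hN C x0 D0 phi j x D.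

Lemma PAM_nonneg k : nonneg_mx (D k).
Proof.
elim: k => [|k IHk] m n; first by rewrite (PAM_D0 gen); case: D0_adm.
rewrite (PAM_update gen); case: ifP => _; last exact: IHk.
by rewrite le_max enorm_ge0.
Qed.

Lemma PAM_diag k m : D k m m = 0.
Proof.
elim: k => [|k IHk]; first by rewrite (PAM_D0 gen); case: D0_adm.
rewrite (PAM_update gen); case: ifP => // /andP[/eqP -> /eqP jj].
by have [] := PAM_index gen k; rewrite /= -jj eqxx.
Qed.

Lemma PAM_argmax k l : D k (j k) l <= D k (j k) (j k.+1).
Proof.
have [->|lj] := eqVneq l (j k); first by rewrite PAM_diag PAM_nonneg.
by have [_] := PAM_index gen k; apply.
Qed.

(** The maximizer is chosen off the diagonal, where the algorithm keeps zeros,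
    so it is a maximizer of the whole row: the bound on the policy can be read
    on the entry that is about to be overwritten. *)
Lemma PAM_row_max k : row_max (D k) (j k) = D k (j k) (j k.+1).
Proof.
apply/eqP; rewrite eq_le; apply/andP; split.
  apply: bigmax_le => [|l _]; [exact: PAM_nonneg|exact: PAM_argmax].
exact: le_bigmax.
Qed.

(** A positive entry is overwritten only as the maximum of its row, and then by
    at least a value of the policy at a nonzero row, which is positive. *)
Lemma PAM_pos k l m n : (k <= l)%N -> 0 < D k m n -> 0 < D l m n.
Proof.
move=> /subnK <-; elim: (l - k)%N => [//|i IHi] /IHi pos; rewrite addSn.
rewrite (PAM_update gen); case: ifP => // /andP[/eqP mj /eqP nj].
have [_ [beta [_ phi0 _]]] := phi_adm.
rewrite lt_max phi0 ?orbT//; first exact: PAM_nonneg.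
by rewrite PAM_row_max -mj -nj gt_eqF.
Qed.

Let rowsum k m := \sum_(n < N) D k m n.

Lemma rowsum_update k :
  rowsum k (j k) - rowsum k.+1 (j k)
  = D k (j k) (j k.+1) - D k.+1 (j k) (j k.+1).
Proof.
rewrite /rowsum (bigD1 (j k.+1))//= [X in _ - X](bigD1 (j k.+1))//=.
rewrite [X in _ - (_ + X)](eq_bigr (fun n => D k (j k) n)); first by lra.
by move=> n /negbTE nj; rewrite (PAM_update gen) nj andbF.
Qed.

Lemma rowsum_fixed k m : j k <> m -> rowsum k.+1 m = rowsum k m.
Proof.
move=> jm; apply: eq_bigr => n _; rewrite (PAM_update gen).
by case: eqP => // mj; case: jm.
Qed.

Hypothesis steps0 : enorm (x k.+1 - x k) @[k --> \oo] --> 0.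

(** If the entry (m, n) is positive and [n] is abandoned, then so is [m]: the
    entry freezes at a value [c > 0], and visits to [m] would keep lowering the
    m-th row sum by a fixed amount. *)
Lemma recurrent_successor k m n : 0 < D k m n ->
  (\forall l \near \oo, j l <> n) -> \forall l \near \oo, j l <> m.
Proof.
move=> Dmn [K _ avoid].
have [_ [beta [/andP[beta0 beta1] _ phi_le]]] := phi_adm.
pose K' := maxn k K; pose c := D K' m n.
have c0 : 0 < c by apply: PAM_pos Dmn; exact: leq_maxl.
have Dc l : (K' <= l)%N -> D l m n = c.
  move=> /subnK <-; elim: (l - K')%N => [//|i <-]; rewrite addSn.
  rewrite (PAM_update gen); case: andP => // -[_ /eqP nj].
  case: (avoid (i + K').+1) => //=.
  by rewrite -addSn; apply: leq_trans (leq_maxr k K) (leq_addl _ _).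
(* Steps below beta * c never exceed beta times the overwritten entry. *)
have [Kb _ small] : \forall l \near \oo, enorm (x l.+1 - x l) < beta * c.
  have bc0 : 0 < beta * c by exact: mulr_gt0.
  move/cvgrPdist_lt/(_ _ bc0) : steps0; apply: filterS => l.
  by rewrite sub0r normrN; apply: le_lt_trans; exact: ler_norm.
have drop l : (maxn K' Kb <= l)%N -> j l = m ->
    (1 - beta) * c <= rowsum l m - rowsum l.+1 m.
  rewrite geq_max => /andP[K'l Kbl] jm.
  have big : c <= D l (j l) (j l.+1) by rewrite -(Dc l K'l) -jm PAM_argmax.
  rewrite -jm rowsum_update (PAM_update gen) !eqxx /=.
  set new := Num.max _ _; have : new <= beta * D l (j l) (j l.+1).
    rewrite ge_max -PAM_row_max phi_le ?andbT; last exact: PAM_nonneg.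
    apply: le_trans (ltW (small l Kbl)) _.
    by rewrite PAM_row_max ler_pM2l.
  have b1 : 0 <= 1 - beta by rewrite subr_ge0 ltW.
  by have := ler_wpM2l b1 big; lra.
have gap0 : rowsum l m - rowsum l.+1 m @[l --> \oo] --> 0.
  apply: nonincreasing_gap_cvg0.
    by move=> l; apply: sumr_ge0 => i _; exact: PAM_nonneg.
  exists (maxn K' Kb) => // l /= Kl; have [jm|/eqP jm] := eqVneq (j l) m.
    have := drop l Kl jm; have : 0 <= (1 - beta) * c by rewrite mulr_ge0; lra.
    lra.
  by rewrite rowsum_fixed.
have gapc : 0 < (1 - beta) * c by rewrite mulr_gt0// subr_gt0.
have /cvgrPdist_lt/(_ _ gapc)[L _ gap] := gap0.
exists (maxn L (maxn K' Kb)) => // l /=.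
rewrite geq_max => /andP[Ll Kl] jm.
have := gap l Ll; rewrite /= sub0r normrN.
by move=> /(le_lt_trans (ler_norm _)); rewrite ltNge drop.
Qed.

(** Abandonment propagates backwards along the paths of positive entries, so
    abandoning [i] would abandon every index, leaving none to visit. *)
Lemma PAM_recurrent i : ~ \forall k \near \oo, j k <> i.
Proof.
move=> avoid_i.
have avoid m : \forall k \near \oo, j k <> m.
  have [->//|mi] := eqVneq m i.
  have [_ _ /(_ m i mi)[p [pth lst]]] := D0_adm.
  elim: p m pth lst {mi} => [m _ /= ->//|a p IHp m /= /andP[Dma pth] lst].
  apply: (@recurrent_successor 0 m a); last exact: IHp pth lst.
  by rewrite (PAM_D0 gen).
have [k] := filter_ex (filter_forall _ avoid).
by move=> /(_ (j k)).
Qed.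

End Memory.

Theorem theorem9 (R : realType) (d N : nat) (hd : (0 < d)%N) (hN : (0 < N)%N)
    (C : 'I_N -> set 'rV[R]_d)
    (C_closed : forall i, closed (C i))
    (C_convex : forall i, @convex_set R 'rV[R]_d (C i))
    (C_meet : \bigcap_(i in [set: 'I_N]) C i !=set0)
    (D0 : 'M[R]_N) (D0_adm : admissible_matrix D0)
    (phi : 'I_N -> 'M[R]_N -> R) (phi_adm : admissible_policy phi)
    (x0 : 'rV[R]_d) (x0_C : C (Ordinal hN) x0)
    (j : nat -> 'I_N) (x : nat -> 'rV[R]_d) (D : nat -> 'M[R]_N)
    (gen : generated_by_PAM hN C x0 D0 phi j x D) :
  exists2 xstar : 'rV[R]_d,
    (\bigcap_(i in [set: 'I_N]) C i) xstar & x @ \oo --> xstar.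
Proof.
have x_proj := PAM_proj gen.
apply: (cvg_proj_arbitrary_order C_closed C_convex C_meet x_proj).
apply: (PAM_recurrent D0_adm phi_adm gen).
exact (steps_cvg0 C_convex C_meet x_proj).
Qed.
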